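(* Let $M\in\mathbb{R}^{m\times m}$ be a diagonally dominant and approximately lower triangular matrix in the following sense: $$|M_{j,i}|\le\epsilon\cdot|M_{i,i}|\qquad\text{for all }1\le j<i\le m.$$ Then there is a universal constant $C>0$ (independent of $M$, $m$ and $\epsilon$) such that $$\mathrm{rank}(M)\ \ge\ C\cdot\min\left\{\left(\frac{1}{\epsilon\log\frac1\epsilon}\right)^2,\ \frac{m}{\log m}\right\}.$$
   Context: $M_{j,i}$ denotes the entry of $M$ in row $j$ and column $i$. ''Diagonally dominant'' means here that in each column the diagonal entry is largest in absolute value: $|M_{j,i}|\le|M_{i,i}|$ for all $1\le i,j\le m$. The parameter $\epsilon>0$ measures the size of the entries above the diagonal relative to the diagonal entry of the same column.
   Formalization: All diagonal entries of M are assumed nonzero (M = 0 is a counterexample otherwise), and ε is kept away from 1: for each δ > 0 the constant C depends on δ only and serves all ε > 0 with |1−ε| ≥ δ, since no uniform C exists as ε → 1. *)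

(* Defs.v *)
From mathcomp Require Import all_boot all_order all_algebra.
From mathcomp Require Import all_classical all_reals all_analysis.

Set Implicit Arguments.
Unset Strict Implicit.
Unset Printing Implicit Defensive.

Import Order.TTheory GRing.Theory Num.Theory.
Local Open Scope ring_scope.

(* This is the entrywise, columnwise notion, not the usual one that compares
   the diagonal entry with the sum of the other entries. *)
Definition diag_dominant (R : realType) (m : nat) (M : 'M[R]_m) : Prop :=
  forall i j : 'I_m, `|M j i| <= `|M i i|.

Definition approx_lower_tri (R : realType) (m : nat) (eps : R)
    (M : 'M[R]_m) : Prop :=
  forall i j : 'I_m, (j < i)%N -> `|M j i| <= eps * `|M i i|.

(* Main.v *)
(* Let r = rank M. Expressing M through r rows spanning a maximal volume gives
   vectors u_j, v_i in R^r with bounded entries such that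
   <u_j, v_i> = M_{j,i} / M_{i,i}. Put A_n = I + (r+1) sum_{j<n} u_j^T u_j. As
   long as n eps^2 <= 1, the vector v_n is small for the quadratic form A_n while
   <u_n, v_n> = 1, so adding u_n multiplies the determinant by at least 3/2. On
   the other hand det A_k is at most polynomial in r and k to the power r. Hence
   k = O(r log k) for every k <= min(m, 1 / eps^2). *)
Require Import Defs.
From mathcomp Require Import all_boot all_order all_fingroup all_algebra.
From mathcomp Require Import all_classical all_reals all_analysis.
From mathcomp Require Import ring lra.

Set Implicit Arguments.
Unset Strict Implicit.
Unset Printing Implicit Defensive.

Import Order.TTheory GRing.Theory Num.Theory.
Local Open Scope ring_scope.

(** * Determinant identities and bounds, and row selection by maximal volume *)

(** Both sides are the determinant of the bordered matrix [block_mx A (- x) y 1%:M]: clearing [y]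
    with the corner 1 leaves [A + x *m y], while clearing [- x] with [A] leaves a Schur complement
    of size 1. *)
Lemma det_rank1_update (R : comUnitRingType) (n : nat) (A : 'M[R]_n)
    (x : 'cV[R]_n) (y : 'rV[R]_n) :
  A \in unitmx ->
  \det (A + x *m y) = \det A * (1 + (y *m invmx A *m x) 0 0).
Proof.
move=> Aunit.
have E1 : block_mx A (- x) y 1%:M *m block_mx 1%:M 0 (- y) 1%:M
   = block_mx (A + x *m y) (- x) 0 (1%:M : 'M[R]_1).
  by rewrite mulmx_block !mulmx1 !mulmx0 !add0r mulNmx mulmxN opprK mul1mx subrr.
have E2 : block_mx A (- x) y 1%:M
   = block_mx A 0 y (1%:M : 'M[R]_1) *m
     block_mx 1%:M (- (invmx A *m x)) 0 (1%:M + y *m invmx A *m x).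
  rewrite mulmx_block !mulmx1 !mulmx0 !mul0mx !mul1mx !addr0.
  by rewrite !mulmxN mulmxA (mulmxV Aunit) mul1mx mulmxA addrCA addNr addr0.
have := congr1 determinant E1.
rewrite det_mulmx E2 det_mulmx det_lblock !det_ublock det_lblock !det1 !mulr1 mul1r.
by move<-; rewrite det_mx11 mxE mxE eqxx.
Qed.

Lemma fact_leq_exp (n : nat) : (n`! <= n ^ n)%N.
Proof.
rewrite fact_prod -[X in (_ <= _ ^ X)%N](subn1 n.+1) -prod_nat_const_nat.
by rewrite !big_nat; apply: leq_prod => i /andP[].
Qed.

(** The Leibniz expansion together with n! <= n^n. This is cruder than Hadamard's bound, but only
    the logarithm of the result matters, up to a constant factor. *)
Lemma ler_norm_det (R : numDomainType) (n : nat) (A : 'M[R]_n) (b : R) :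
  (forall i j, `|A i j| <= b) -> `|\det A| <= (n%:R * b) ^+ n.
Proof.
move=> Ab; rewrite exprMn.
apply: (@le_trans _ _ (\sum_(s : 'S_n) b ^+ n)).
  apply: (le_trans (ler_norm_sum _ _ _)); apply: ler_sum => s _.
  rewrite normrM normrX normrN1 expr1n mul1r normr_prod.
  rewrite -[X in b ^+ X](card_ord n) -prodr_const.
  by apply: ler_prod => i _; rewrite normr_ge0 Ab.
(* In size 0 the hypothesis is vacuous and [b] may be negative, hence the case split. *)
case: n A Ab => [|n] A Ab.
  by rewrite sumr_const card_Sn !expr0 mul1r.
have b0 : 0 <= b by apply: le_trans (Ab 0 0).
rewrite sumr_const card_Sn -[leLHS]mulr_natl -natrX.
by rewrite ler_wpM2r ?exprn_ge0// ler_nat fact_leq_exp.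
Qed.

(* By Cramer's rule, the coefficients are ratios of r x r minors, the
   denominator being the largest minor. *)
Lemma bounded_row_combination (R : realFieldType) (m n : nat) (M : 'M[R]_(m, n)) :
  exists (f : 'I_(\rank M) -> 'I_m) (U : 'M[R]_(m, \rank M)),
    M = U *m rowsub f M /\ forall i j, `|U i j| <= 1.
Proof.
set r := \rank M; pose B : 'M[R]_(m, r) := col_base M.
have Bfull : row_full B by exact: col_base_full.
(* Selections with repeated rows are allowed: they have volume 0 and are never maximal. *)
pose vol (f : {ffun 'I_r -> 'I_m}) := `|\det (rowsub f B)|.
pose f0 := [ffun i => fullrankfun Bfull i].
have vol0 : 0 < vol f0.
  rewrite normr_gt0 -unitfE -[_ \is a _]/(_ \in unitmx).
  have -> : rowsub f0 B = rowsub (fullrankfun Bfull) B.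
    by apply/matrixP=> i j; rewrite !mxE ffunE.
  exact: fullrowsub_unit.
have [f _ fmax] := @arg_maxP _ _ _ f0 predT vol isT.
have volf : 0 < vol f by exact: lt_le_trans vol0 (fmax f0 isT).
pose B0 := rowsub f B.
have B0unit : B0 \in unitmx by rewrite unitmxE unitfE -normr_gt0.
exists f, (B *m invmx B0); split.
  have -> : rowsub f M = B0 *m row_base M by rewrite mul_rowsub_mx mulmx_base.
  by rewrite mulmxA mulmxKV // mulmx_base.
move=> i j.
(* Cramer's rule: replacing row j of [B0] by row i of [B] leaves the cofactors along row j
   unchanged. *)
pose g := [ffun k => if k == j then i else f k].
suff -> : (B *m invmx B0) i j = \det (rowsub g B) / \det B0.
  by rewrite normrM normfV ler_pdivrMr// mul1r; exact: fmax.
rewrite (expand_det_row _ j) mulr_suml mxE; apply: eq_bigr => k _.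
rewrite /invmx B0unit !mxE ffunE eqxx -mulrA; congr (_ * _).
rewrite mulrC; congr (_ / _).
rewrite /cofactor; congr (_ * \det _).
by apply/matrixP => a b; rewrite !mxE ffunE eq_sym (negbTE (neq_lift _ _)).
Qed.

(** * The determinant potential *)

Section Potential.
Variables (R : realFieldType) (r : nat).
Implicit Types (u : nat -> 'rV[R]_r) (x : 'cV[R]_r).

(** The identity makes the determinant start at 1. The weight r+1 balances the two parts of the
    quadratic form at v: the squared length of v is at most r, and the weighted sum is at most
    r+1. *)
Definition reg_gram u (n : nat) : 'M[R]_r :=
  1%:M + r.+1%:R *: \sum_(i < n) (u i)^T *m u i.

Lemma reg_gram_quad u n x :
  (x^T *m reg_gram u n *m x) 0 0
    = \sum_j x j 0 ^+ 2 + r.+1%:R * \sum_(i < n) (u i *m x) 0 0 ^+ 2.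
Proof.
rewrite /reg_gram mulmxDr mulmxDl mulmx1 -scalemxAr -scalemxAl mxE.
congr (_ + _).
  by rewrite mxE; apply: eq_bigr => j _; rewrite !mxE.
rewrite mxE; congr (_ * _).
rewrite mulmx_sumr mulmx_suml summxE; apply: eq_bigr => i _.
rewrite mulmxA -[_ *m x]mulmxA -trmx_mul mxE big_ord1 expr2; congr (_ * _).
by rewrite mxE.
Qed.

Lemma reg_gram_sym u n : (reg_gram u n)^T = reg_gram u n.
Proof.
rewrite /reg_gram linearD /= trmx1 linearZ /= linear_sum /=; congr (_ + _ *: _).
by apply: eq_bigr => i _; rewrite trmx_mul trmxK.
Qed.

(* With q x = x^T A x, A = reg_gram u n and w = A^-1 (u n)^T, expanding
   0 <= q (v - 2(r+1) w) bounds u A^-1 u^T from below. *)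
Lemma det_reg_gram_step u n (v : 'cV[R]_r) (eps : R) :
  (forall j, `|v j 0| <= 1) ->
  (u n *m v) 0 0 = 1 ->
  (forall i, (i < n)%N -> `|(u i *m v) 0 0| <= eps) ->
  n%:R * eps ^+ 2 <= 1 ->
  0 < \det (reg_gram u n) ->
  3 / 2 * \det (reg_gram u n) <= \det (reg_gram u n.+1).
Proof.
move=> v1 uv uveps neps detA.
set A := reg_gram u n in detA *; set N : R := r.+1%:R.
have N0 : 0 < N by rewrite ltr0n.
have Aunit : A \in unitmx by rewrite unitmxE unitfE gt_eqF.
have -> : reg_gram u n.+1 = A + (N *: (u n)^T) *m u n.
  by rewrite /A /reg_gram big_ord_recr /= scalerDr addrA scalemxAl.
(* The determinant grows by the factor 1 + N s, with s the value of the inverse form at [u n], so N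
   s >= 1/2 is what remains to prove. *)
rewrite det_rank1_update // mulrC ler_pM2l //.
pose w := invmx A *m (u n)^T.
have Aw : A *m w = (u n)^T by rewrite mulmxA mulmxV // mul1mx.
have -> : (u n *m invmx A *m (N *: (u n)^T)) 0 0 = N * (u n *m w) 0 0.
  by rewrite -scalemxAr mxE mulmxA.
set s := (u n *m w) 0 0.
have qv : (v^T *m A *m v) 0 0 <= 2 * N.
  rewrite reg_gram_quad.
  have -> : 2 * N = (N - 1) + 1 + N * 1 :> R by ring.
  apply: lerD.
    rewrite /N -natr1 addrK; apply: (@le_trans _ _ (\sum_(j < r) 1)).
      by apply: ler_sum => j _; rewrite -real_normK ?num_real // expr_le1.
    by rewrite sumr_const card_ord lerDl.
  rewrite ler_pM2l //; apply: le_trans neps.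
  rewrite -[X in X%:R * _]card_ord mulr_natl -sumr_const.
  apply: ler_sum => i _; rewrite -real_normK ?num_real //.
  have h := uveps i (ltn_ord i).
  by rewrite lerXn2r // nnegrE // (le_trans (normr_ge0 _) h).
have wTA : w^T *m A = u n by rewrite -[A]reg_gram_sym -trmx_mul Aw trmxK.
(* This is Cauchy-Schwarz in disguise. The coefficient 2 N is the bound [qv]; the expansion q(v) - 4
   N + 4 N^2 s is then at most 4 N (N s - 1/2). *)
have : 0 <= ((v - (2 * N) *: w)^T *m A *m (v - (2 * N) *: w)) 0 0.
  rewrite reg_gram_quad addr_ge0 ?mulr_ge0 ?sumr_ge0 ?ler0n// => *; exact: sqr_ge0.
have vu : (v^T *m (u n)^T) 0 0 = 1 by rewrite -trmx_mul mxE.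
rewrite [(v - _)^T]linearB /= [(_ *: w)^T]linearZ /=.
rewrite mulmxBl -scalemxAl wTA mulmxBl !mulmxBr -!scalemxAl -!scalemxAr.
have mxB (X Y : 'M[R]_1) : (X - Y) 0 0 = X 0 0 - Y 0 0 by rewrite !mxE.
have mxZ c (X : 'M[R]_1) : (c *: X) 0 0 = c * X 0 0 by rewrite mxE.
rewrite -[v^T *m A *m w]mulmxA Aw !(mxB, mxZ) vu uv -/s => h.
suff: 0 <= N * s - 1 / 2 by lra.
have : 0 <= (4 * N) * (N * s - 1 / 2) by lra.
by rewrite pmulr_rge0 // mulr_gt0.
Qed.

Lemma det_reg_gram_ge u k (v : nat -> 'cV[R]_r) (eps : R) :
  (forall i j, (i < k)%N -> `|v i j 0| <= 1) ->
  (forall i, (i < k)%N -> (u i *m v i) 0 0 = 1) ->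
  (forall i j, (j < i)%N -> (i < k)%N -> `|(u j *m v i) 0 0| <= eps) ->
  k%:R * eps ^+ 2 <= 1 ->
  (3 / 2) ^+ k <= \det (reg_gram u k).
Proof.
move=> v1 uv uveps keps.
suff H n : (n <= k)%N -> (3 / 2) ^+ n <= \det (reg_gram u n) by exact: H.
elim: n => [|n IHn] nk.
  by rewrite expr0 /reg_gram big_ord0 scaler0 addr0 det1.
have {}IHn := IHn (ltnW nk).
have det0 : 0 < \det (reg_gram u n) by apply: lt_le_trans IHn; rewrite exprn_gt0 //; lra.
apply: le_trans (@det_reg_gram_step u n (v n) eps _ _ _ _ det0).
- by rewrite exprS ler_pM2l//; lra.
- by move=> j; exact: v1.
- exact: uv.
- by move=> i ni; exact: uveps.
- apply: le_trans keps; rewrite ler_wpM2r ?sqr_ge0 // ler_nat; exact: ltnW.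
Qed.

Lemma det_reg_gram_le u k :
  (forall i j, (i < k)%N -> `|u i 0 j| <= 1) ->
  \det (reg_gram u k) <= (r%:R * (1 + r.+1%:R * k%:R)) ^+ r.
Proof.
move=> u1; apply: le_trans (ler_norm _) _; apply: ler_norm_det => i j.
rewrite mxE (le_trans (ler_normD _ _))// lerD//.
  by rewrite mxE; case: eqP => _; rewrite ?normr1 ?normr0.
rewrite mxE normrM normr_nat ler_pM2l ?ltr0n// summxE.
apply: le_trans (ler_norm_sum _ _ _) _.
rewrite -[X in _ <= X%:R]card_ord -sumr_const; apply: ler_sum => l _.
by rewrite mxE big_ord1 mxE normrM mulr_ile1 // u1.
Qed.

End Potential.

(** * From the potential to a rank bound *)

Lemma approx_lower_tri_exp_rank (R : realType) (m k : nat) (eps : R) (M : 'M[R]_m) :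
  (forall i : 'I_m, M i i != 0) -> diag_dominant M -> approx_lower_tri eps M ->
  (k <= m)%N -> k%:R * eps ^+ 2 <= 1 ->
  (3 / 2) ^+ k <= ((\rank M)%:R * (1 + (\rank M).+1%:R * k%:R)) ^+ \rank M :> R.
Proof.
move=> M0 Mdd Mlt km keps; have [f [U [MU U1]]] := bounded_row_combination M.
(* Both families are extended by 0 beyond m; only indices below k <= m are used. Dividing column i
   by [M i i] makes the diagonal products 1, and diagonal dominance bounds the entries of [v] by
   1. *)
pose u (n : nat) := oapp (fun i : 'I_m => row i U) 0 (insub n).
pose v (n : nat) :=
  oapp (fun i : 'I_m => (M i i)^-1 *: col i (rowsub f M)) 0 (insub n).
have uv (j i : 'I_m) : (u j *m v i) 0 0 = M j i / M i i.
  rewrite /u /v !valK /= -scalemxAr mxE mulrC; congr (_ / _).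
  by rewrite [in RHS]MU !mxE; apply: eq_bigr => l _; rewrite !mxE.
have ordP n : (n < k)%N -> exists i : 'I_m, n = i.
  by move=> nk; exists (Ordinal (leq_trans nk km)).
apply: (le_trans (@det_reg_gram_ge _ _ u k v eps _ _ _ keps)); last first.
- apply: det_reg_gram_le => n j /ordP[i ->].
  by rewrite /u valK mxE; exact: U1.
- move=> n p np /[dup] /ordP[i ie] pk; have [j je] := ordP p (ltn_trans np pk).
  rewrite ie je uv normrM normfV ler_pdivrMr ?normr_gt0//.
  by apply: Mlt; rewrite -ie -je.
- by move=> n /ordP[i ->]; rewrite uv divff.
- move=> n j /ordP[i ->]; rewrite /v valK !mxE mulrC normrM normfV.
  by rewrite ler_pdivrMr ?normr_gt0// mul1r; exact: Mdd.
Qed.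

(** Logarithms of the previous bound, whose base is at most (k+1)^3 when r < k. When k <= r the
    claim follows from ln (3/2) <= ln (k+1) alone. *)
Lemma approx_lower_tri_rank (R : realType) (m k : nat) (eps : R) (M : 'M[R]_m) :
  (forall i : 'I_m, M i i != 0) -> diag_dominant M -> approx_lower_tri eps M ->
  (k <= m)%N -> k%:R * eps ^+ 2 <= 1 ->
  k%:R * ln (3 / 2) <= 3 * (\rank M)%:R * ln (k.+1%:R) :> R.
Proof.
move=> M0 Mdd Mlt km keps.
have := approx_lower_tri_exp_rank M0 Mdd Mlt km keps.
set r := \rank M.
have [->|k0] := posnP k; first by move=> _; rewrite mul0r ln1 mulr0.
have lnk : 0 <= ln (k.+1%:R : R) by rewrite ln_ge0// ler1n.
have [rk|kr _] := ltnP r k; last first.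
  rewrite -mulrA mulrCA; apply: ler_pM.
  - exact: ler0n.
  - by rewrite ln_ge0//; lra.
  - by rewrite ler_nat.
  - apply: (@le_trans _ _ (ln (k.+1%:R))); last by lra.
    rewrite ler_ln ?posrE ?ltr0n//.
    apply: (@le_trans _ _ 2); [lra|by rewrite ler_nat].
(* Rank 0 would give (3/2)^k <= 1 with k > 0. *)
have [->|r0] := posnP r.
  rewrite expr0 mulr0 mul0r => h.
  have : 1 < (3 / 2 : R) ^+ k by rewrite exprn_egt1 -?lt0n//; lra.
  by lra.
have b0 : 0 < r%:R * (1 + r.+1%:R * k%:R) :> R.
  by rewrite mulr_gt0 ?ltr0n// ltr_pwDl// mulr_ge0.
have bk : r%:R * (1 + r.+1%:R * k%:R) <= k.+1%:R ^+ 3 :> R.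
  rewrite -natrM -[1]/(1%:R) -natrD -natrM -natrX ler_nat.
  rewrite (@leq_trans (k.+1 * (k.+1 * k.+1)))//.
    apply: leq_mul; first by rewrite ltnW// ltnS ltnW.
    by rewrite mulSn; apply: leq_add => //; apply: leq_mul; rewrite // ltnW.
move=> h.
have : ln ((3 / 2) ^+ k) <= ln ((r%:R * (1 + r.+1%:R * k%:R)) ^+ r) :> R.
  by rewrite ler_ln ?posrE ?exprn_gt0//.
rewrite !lnXn//.
rewrite -[ln _ *+ k]mulr_natl -[ln _ *+ r]mulr_natl => /le_trans; apply.
rewrite [3 * _]mulrC -mulrA ler_pM2l ?ltr0n//.
rewrite [3 * _]mulr_natl -lnXn ?ltr0n// ler_ln ?posrE ?exprn_gt0 ?ltr0n//.
Qed.

(** * The constant, and the cases in eps and m *)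

Lemma ln_ge1BV (R : realType) (x : R) : 0 < x -> 1 - x^-1 <= ln x.
Proof.
move=> x0; have := @le_ln1Dx R (x^-1 - 1).
rewrite subrKC lnV ?posrE//.
have : 0 < x^-1 by rewrite invr_gt0.
by move=> h1 h2; have := h2 ltac:(lra); lra.
Qed.

(** Near eps = 1 the logarithm vanishes and the first term of the minimum blows up; [delta] keeps
    eps away from 1, and the constant depends on [delta] alone. A nonzero diagonal excludes the zero
    matrix, which satisfies both entrywise conditions. *)
Theorem lemma4p3 (R : realType) (delta : R) (delta_gt0 : 0 < delta) :
  exists2 C : R, 0 < C &
    forall (m : nat) (eps : R) (M : 'M[R]_m),
      0 < eps ->
      delta <= `|1 - eps| ->
      (forall i : 'I_m, M i i != 0) ->
      diag_dominant M ->
      approx_lower_tri eps M ->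
      C * Num.min ((1 / (eps * ln (1 / eps))) ^+ 2) (m%:R / ln m%:R)
        <= (\rank M)%:R.
Proof.
set c : R := ln (3 / 2).
have c0 : 0 < c by rewrite ln_gt0//; lra.
(* [c1] serves eps >= 1, [c2] serves m <= eps^-2, and [c3] serves eps < 1 with eps^-2 < m. *)
pose c1 := delta ^+ 2; pose c2 := c / 6.
pose c3 := c * delta ^+ 2 / (6 * (1 + 2 * delta)).
have c1_gt0 : 0 < c1 by rewrite exprn_gt0.
have c2_gt0 : 0 < c2 by rewrite divr_gt0.
have c3_gt0 : 0 < c3 by rewrite !(mulr_gt0, invr_gt0, exprn_gt0)//; lra.
exists (Num.min c1 (Num.min c2 c3)); first by rewrite !lt_min c1_gt0 c2_gt0.
move=> m eps M eps0 deps M0 Mdd Mlt.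
set S := (1 / _) ^+ 2; set T := m%:R / ln m%:R.
set C := Num.min c1 _.
have Cge0 : 0 <= C by rewrite !le_min !ltW.
have Cc1 : C <= c1 by rewrite ge_min lexx.
have Cc2 : C <= c2 by rewrite !ge_min lexx orbT.
have Cc3 : C <= c3 by rewrite !ge_min lexx !orbT.
have S0 : 0 <= S by exact: sqr_ge0.
have T0 : 0 <= T.
  rewrite divr_ge0//; case: (m) => [|p]; last by rewrite ln_ge0// ler1n.
  by rewrite ln0.
suff : C * S <= (\rank M)%:R \/ C * T <= (\rank M)%:R.
  by case; apply: le_trans; rewrite ler_wpM2l// ge_min lexx ?orbT.
have [m1|m2] := leqP m 1.
  (* For m = 1 the quotient is 0 by the convention that the inverse of [ln 1 = 0] is 0. *)
  right; suff -> : T = 0 by rewrite mulr0.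
  rewrite /T; case: m m1 {M M0 Mdd Mlt T T0} => [|[|//]] _; rewrite ?mul0r//.
  by rewrite ln1 invr0 mulr0.
have r1 : 1 <= (\rank M)%:R :> R.
  rewrite ler1n lt0n mxrank_eq0; apply/eqP => M00.
  by have := M0 (Ordinal (ltnW m2)); rewrite M00 mxE eqxx.
have lne : ln (1 / eps) = - ln eps by rewrite div1r lnV.
have [eps1|eps1] := leP 1 eps.
  (* Here eps ln eps >= eps - 1 >= delta, so S <= delta^-2 and rank at least 1 suffices. *)
  left; apply: le_trans r1.
  have e1 : eps - 1 <= eps * ln eps.
    rewrite -(@ler_pM2l _ eps^-1) ?invr_gt0// mulKf ?gt_eqF//.
    by rewrite mulrBr mulVf ?gt_eqF// mulr1 ln_ge1BV.
  have e2 : delta <= eps * ln eps.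
    by move: deps; rewrite ler0_norm; lra.
  rewrite /S lne mulrN div1r invrN sqrrN exprVn.
  rewrite ler_pdivrMr ?exprn_gt0//; last by lra.
  by rewrite mul1r (le_trans Cc1)// lerXn2r// nnegrE; lra.
have deps1 : delta <= 1 - eps by move: deps; rewrite ger0_norm; lra.
(* [K] is the largest value allowed for k by k eps^2 <= 1. The rank bound is applied with k = m if m
   <= K, and with k the integer part of K otherwise. *)
pose K := (eps ^+ 2)^-1.
have e20 : 0 < eps ^+ 2 by rewrite exprn_gt0.
have K1 : 1 <= K by rewrite invf_ge1// expr_le1// ltW.
have [mK|Km] := leP m%:R K.
  right.
  have key : m%:R * c <= 3 * (\rank M)%:R * ln m.+1%:R.
    apply: (approx_lower_tri_rank M0 Mdd Mlt (leqnn m)).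
    by rewrite -ler_pdivlMr// div1r.
  have lnm : 0 < ln (m%:R : R) by rewrite ln_gt0// ltr1n.
  (* This uses m + 1 <= m^2, valid from m = 2 on. *)
  have lnS : ln m.+1%:R <= 2 * ln m%:R :> R.
    rewrite mulr_natl -lnXn ?ltr0n ?(ltnW m2)//.
    rewrite ler_ln ?posrE ?exprn_gt0 ?ltr0n ?(ltnW m2)//.
    rewrite -natrX ler_nat expnS expn1 (leq_trans _ (leq_mul m2 (leqnn m)))//.
    by rewrite mul2n -addnn -addn1 leq_add2l ltnW.
  rewrite /T mulrA ler_pdivrMr//.
  have : C * m%:R <= c2 * m%:R by rewrite ler_wpM2r.
  have : 3 * (\rank M)%:R * ln m.+1%:R <= 3 * (\rank M)%:R * (2 * ln m%:R) :> R.
    by rewrite ler_wpM2l ?mulr_ge0.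
  by rewrite /c2; lra.
left.
pose k := Num.truncn K.
have /andP[kK Kk] : k%:R <= K < k.+1%:R by rewrite truncn_itv; lra.
have km : (k <= m)%N by rewrite -(ler_nat R); lra.
have k1 : (1 <= k)%N by rewrite -ltnS -(ltr_nat R); lra.
have key : k%:R * c <= 3 * (\rank M)%:R * ln k.+1%:R.
  by apply: (approx_lower_tri_rank M0 Mdd Mlt km); rewrite -ler_pdivlMr// div1r.
pose L := - ln eps.
have Ldelta : delta <= L.
  have := @le_ln1Dx R (eps - 1); rewrite subrKC => h; rewrite /L.
  by have := h ltac:(lra); lra.
(* From k + 1 <= 2 K the logarithm is at most ln 2 + 2 L, and ln 2 <= 1 <= L / delta. *)
have lnK : ln k.+1%:R <= (delta^-1 + 2) * L.
  have kR : 1 <= k%:R :> R by rewrite ler1n.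
  apply: (@le_trans _ _ (ln (2 * K))).
    rewrite ler_ln ?posrE ?ltr0n//; last by lra.
    by rewrite -natr1; lra.
  rewrite lnM ?posrE//; last by lra.
  rewrite lnV ?posrE// lnXn// mulrDl; apply: lerD.
    apply: (@le_trans _ _ 1).
      by have := @le_ln1Dx R 1; rewrite (_ : 1 + 1 = 2 :> R)// => -> //; lra.
    by rewrite mulrC ler_pdivlMr// mul1r.
  by rewrite /L mulr_natl mulNrn.
have SE : S = K / L ^+ 2.
  by rewrite /S lne -/L div1r exprVn exprMn invfM.
have L0 : 0 < L by lra.
rewrite SE mulrA ler_pdivrMr ?exprn_gt0//.
set r : R := (\rank M)%:R in r1 key *.
have Kc : K * c <= 6 * r * ((delta^-1 + 2) * L).
  have h1 : K * c <= 2 * (k%:R * c).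
    rewrite mulrA ler_pM2r//.
    have : 1 <= k%:R :> R by rewrite ler1n.
    by move: Kk; rewrite -natr1; lra.
  have : 3 * r * ln k.+1%:R <= 3 * r * ((delta^-1 + 2) * L).
    by rewrite ler_wpM2l// mulr_ge0//; lra.
  by lra.
(* The constant [c3] turns [Kc] into c3 K <= r delta L, and delta <= L yields the required r L^2. *)
apply: (@le_trans _ _ (c3 * K)); first by rewrite ler_wpM2r//; lra.
have -> : c3 * K = delta ^+ 2 / (6 * (1 + 2 * delta)) * (K * c).
  by rewrite /c3; ring.
have d0 : 0 < delta ^+ 2 / (6 * (1 + 2 * delta)).
  by rewrite divr_gt0 ?exprn_gt0// mulr_gt0//; lra.
apply: le_trans (_ : delta ^+ 2 / (6 * (1 + 2 * delta)) * (6 * r * ((delta^-1 + 2) * L)) <= _).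
  by rewrite ler_pM2l.
have -> : delta ^+ 2 / (6 * (1 + 2 * delta)) * (6 * r * ((delta^-1 + 2) * L))
   = r * (delta * L).
  by field; rewrite !gt_eqF//; lra.
by rewrite ler_pM2l ?expr2 ?ler_pM2r//; lra.
Qed.
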